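(* For each integer $p>1$, the incidence structure $\mathscr{D}^3_p=\mathscr{D}(B,G)$ defined in the context is a $2$-$(v,k,\lambda)$ design with $v=p^8+p^4+1$ and $k=p^4+1$, for some $\lambda$, and $G$ is a $3$-grid-imprimitive group of automorphisms of it that is transitive on blocks.
   Context: Let $e_1=p^2+p+1$, $e_2=p^2-p+1$, $e_3=p^4-p^2+1$, and $\mathcal{P}=\mathbb{Z}_{e_1}\times\mathbb{Z}_{e_2}\times\mathbb{Z}_{e_3}$, where elements of $\mathbb{Z}_{e}$ are represented by $0,1,\dots,e-1$. Let $G=\mathrm{Sym}(\mathbb{Z}_{e_1})\times\mathrm{Sym}(\mathbb{Z}_{e_2})\times\mathrm{Sym}(\mathbb{Z}_{e_3})$ act coordinatewise on $\mathcal{P}$. For $B\subseteq\mathcal{P}$, $\mathscr{D}(B,G)$ is the incidence structure with point set $\mathcal{P}$ and block set $\{B^g : g\in G\}$. A $2$-$(v,k,\lambda)$ design has $v$ points, blocks of size $k$, and every pair of distinct points in exactly $\lambda$ blocks. A permutation group on $\mathcal{P}$ is $3$-grid-imprimitive if $\mathcal{P}$ can be identified with a Cartesian product of three sets of size $>1$ such that the group is contained in the direct product of the three symmetric groups acting coordinatewise. Write $n=\frac{p^2-p}{2}$. The set $B$ is $B=(B'\times\{0\})\cup B_3$, where $B'\subseteq\mathbb{Z}_{e_1}\times\mathbb{Z}_{e_2}$ consists of the points $(a,0)$ for $0\le a\le p$, together with $(p+a,2a-1)$ and $(p+a,2a)$ for $1\le a\le n$, and $B_3\subseteq\mathcal{P}$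 is as follows. If $p=2$: $B_3=\{(3+a,b,c-1),(3+a,b,c) : 1\le a\le3,\ 1\le b\le2,\ c=2(a+3(b-1))\}$. If $p>2$: $B_3=B_{3,1}\cup B_{3,2}\cup B_{3,3}\cup B_{3,4}$. Set $m=\frac{p^2-1}{2}$ and $m'=\frac{p^2-2p+1}{2}$ if $p$ is odd, and $m=\frac{p^2-2p}{2}$ and $m'=\frac{p^2}{2}$ if $p$ is even. Then: $B_{3,1}$ consists of the points $(a,b,c-1)$ and $(a,b,c)$ for $1\le a\le p$, $1\le b\le m$, $c=2(a+(b-1)p)$. $B_{3,2}$ consists of the points $(p+a,b+\delta,c-1)$ and $(p+a,b+\delta,c)$ for $1\le a\le n$, $1\le b\le n$, $c=2pm+2(a+(b-1)n)$, where $\delta=n$ if $1\le a\le\lfloor\frac{p^2-p+2}{4}\rfloor$ and $b\in\{2a-1,2a\}$, and $\delta=0$ otherwise. $B_{3,3}$ consists of the points $(\frac{p^2+p}{2}+a,\,m+b,\,c-1)$ and $(\frac{p^2+p}{2}+a,\,m+b,\,c)$ for $1\le a\le p$, $1\le b\le m'$, $c=2c_0+2(a+(b-1)p)$, where $c_0=\frac{p^4+p^2-2p}{4}$ if $p$ is odd and $c_0=\frac{p^4-3p^2}{4}$ if $p$ is even. $B_{3,4}$ consists of the points $(\frac{p^2+3p}{2}+a,\,b+\delta,\,c-1)$ and $(\frac{p^2+3p}{2}+a,\,b+\delta,\,c)$ for $1\le a\le n$, $1\le b\le n$, $c=2\cdot\frac{p^4+2p^3-3p^2}{4}+2(a+(b-1)n)$,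 where $\delta=0$ if $a=1$ and $\delta=n$ otherwise. *)

(* Defs.v *)
From mathcomp Require Import all_boot all_fingroup.

Set Implicit Arguments.
Unset Strict Implicit.
Unset Printing Implicit Defensive.

(* Coordinatewise action of Sym(X) x Sym(Y) x Sym(Z) on X x Y x Z.            *)

Section Grid.

Variables X Y Z : finType.

Definition grid_fun (g : {perm X} * {perm Y} * {perm Z}) (x : X * Y * Z) :
    X * Y * Z :=
  (g.1.1 x.1.1, g.1.2 x.1.2, g.2 x.2).

Lemma grid_fun_inj g : injective (grid_fun g).
Proof.
by move=> [[x1 x2] x3] [[y1 y2] y3] [] /perm_inj -> /perm_inj -> /perm_inj ->.
Qed.

Definition grid_perm g : {perm X * Y * Z} := perm (@grid_fun_inj g).

Lemma grid_permM : {in [set: {perm X} * {perm Y} * {perm Z}] &,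
  {morph grid_perm : g h / (g * h)%g}}.
Proof.
move=> g h _ _; apply/permP => x.
by rewrite permM !permE /grid_fun /= !permM.
Qed.

Canonical grid_morphism := Morphism grid_permM.

Definition grid_group : {group {perm X * Y * Z}} :=
  (grid_morphism @* [set: {perm X} * {perm Y} * {perm Z}])%G.

End Grid.

Definition grid_imprimitive3 (T : finType) (H : {group {perm T}}) : Prop :=
  exists (X Y Z : finType) (f : T -> X * Y * Z),
    [/\ bijective f,
        [/\ 1 < #|X|, 1 < #|Y| & 1 < #|Z|] &
        forall h, h \in H ->
          exists2 g, g \in grid_group X Y Z & forall x, f (h x) = g (f x)].

(* An incidence structure with point set T is given by its set of blocks,     *)
(* a member of {set {set T}}.                                                 *)

Section Designs.

Variable T : finType.

Definition incidence_structure (B : {set T}) (H : {group {perm T}}) :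
    {set {set T}} :=
  orbit 'P^*%act H B.

Definition is_2design (v k lambda : nat) (D : {set {set T}}) : Prop :=
  [/\ #|T| = v,
      forall b, b \in D -> #|b| = k &
      forall x y : T, x != y ->
        #|[set b in D | (x \in b) && (y \in b)]| = lambda].

Definition automorphism_group (D : {set {set T}}) : {group {perm T}} :=
  ('N(D | 'P^*))%G.

End Designs.

Definition e1 (p : nat) := p ^ 2 + p + 1.
Definition e2 (p : nat) := p ^ 2 - p + 1.
Definition e3 (p : nat) := p ^ 4 - p ^ 2 + 1.

Definition point (p : nat) : finType := ('I_(e1 p) * 'I_(e2 p) * 'I_(e3 p))%type.

Definition G (p : nat) : {group {perm point p}} :=
  grid_group 'I_(e1 p) 'I_(e2 p) 'I_(e3 p).

(* The base block is listed through the representatives 0, ..., e - 1 of its  *)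
(* coordinates. For p > 1 all the divisions below except the one marked as a  *)
(* floor are exact, and no subtraction is truncated.                          *)

Definition half (p : nat) := (p ^ 2 - p) %/ 2.

Definition B'_seq (p : nat) : seq (nat * nat) :=
  [seq (a, 0) | a <- iota 0 p.+1] ++
  flatten [seq [:: (p + a, 2 * a - 1); (p + a, 2 * a)] | a <- iota 1 (half p)].

Definition pair_at (a b c : nat) : seq (nat * nat * nat) :=
  [:: (a, b, c - 1); (a, b, c)].

Definition B3_two : seq (nat * nat * nat) :=
  flatten [seq pair_at (3 + a) b (2 * (a + 3 * (b - 1)))
          | a <- iota 1 3, b <- iota 1 2].

Definition m (p : nat) :=
  if odd p then (p ^ 2 - 1) %/ 2 else (p ^ 2 - 2 * p) %/ 2.

Definition m' (p : nat) :=
  if odd p then (p ^ 2 - 2 * p + 1) %/ 2 else p ^ 2 %/ 2.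

Definition c0 (p : nat) :=
  if odd p then (p ^ 4 + p ^ 2 - 2 * p) %/ 4 else (p ^ 4 - 3 * p ^ 2) %/ 4.

Definition B31 (p : nat) : seq (nat * nat * nat) :=
  flatten [seq pair_at a b (2 * (a + (b - 1) * p))
          | a <- iota 1 p, b <- iota 1 (m p)].

Definition delta2 (p a b : nat) :=
  (* floor *)
  if (1 <= a <= (p ^ 2 - p + 2) %/ 4) && (b \in [:: 2 * a - 1; 2 * a])
  then half p else 0.

Definition B32 (p : nat) : seq (nat * nat * nat) :=
  flatten [seq pair_at (p + a) (b + delta2 p a b)
                 (2 * p * m p + 2 * (a + (b - 1) * half p))
          | a <- iota 1 (half p), b <- iota 1 (half p)].

Definition B33 (p : nat) : seq (nat * nat * nat) :=
  flatten [seq pair_at ((p ^ 2 + p) %/ 2 + a) (m p + b)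
                 (2 * c0 p + 2 * (a + (b - 1) * p))
          | a <- iota 1 p, b <- iota 1 (m' p)].

Definition delta4 (p a : nat) := if a == 1 then 0 else half p.

Definition B34 (p : nat) : seq (nat * nat * nat) :=
  flatten [seq pair_at ((p ^ 2 + 3 * p) %/ 2 + a) (b + delta4 p a)
                 (2 * ((p ^ 4 + 2 * p ^ 3 - 3 * p ^ 2) %/ 4)
                  + 2 * (a + (b - 1) * half p))
          | a <- iota 1 (half p), b <- iota 1 (half p)].

Definition B3_seq (p : nat) : seq (nat * nat * nat) :=
  if p == 2 then B3_two else B31 p ++ B32 p ++ B33 p ++ B34 p.

Definition B_seq (p : nat) : seq (nat * nat * nat) :=
  [seq (x, 0) | x <- B'_seq p] ++ B3_seq p.

Definition B (p : nat) : {set point p} :=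
  [set x | (nat_of_ord x.1.1, nat_of_ord x.1.2, nat_of_ord x.2) \in B_seq p].

Definition D3 (p : nat) : {set {set point p}} := incidence_structure (B p) (G p).

(* Main.v *)
(* The orbits of the grid group on ordered pairs of points are the eight
   difference types J (the set of coordinates in which the two points differ),
   so the orbit of B is a 2-design as soon as, for each nonempty J, the number
   of ordered pairs of B of type J is proportional to the number of such pairs
   of points. Since k(k - 1) = v - 1 here, the number required is the product of
   the e_j - 1 for j in J. By inclusion-exclusion this amounts to: for each set K of
   coordinates, the ordered pairs of B agreeing outside K number p^4 plus the
   product of the e_j for j in K. For K containing the third coordinate, the
   count is a sum of squares of fibre sizes. Otherwise it reduces to B', because
   each positive third coordinate occurs exactly once in B. *)
Require Import Defs.
From mathcomp Require Import all_boot all_fingroup.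
From mathcomp Require Import zify.

Set Implicit Arguments.
Unset Strict Implicit.
Unset Printing Implicit Defensive.

(** * Designs from the grid group *)

(** Stated for eqTypes so as to serve both the points, with ordinal coordinates, and the listed
    triples of naturals. *)
Definition difference_type (X Y Z : eqType) (x y : X * Y * Z) : bool * bool * bool :=
  (x.1.1 != y.1.1, x.1.2 != y.1.2, x.2 != y.2).

(** The number of points at difference type J from a fixed point of an a by b by c grid. *)
Definition weight (a b c : nat) (J : bool * bool * bool) : nat :=
  (if J.1.1 then a.-1 else 1) * (if J.1.2 then b.-1 else 1) *
  (if J.2 then c.-1 else 1).

Lemma sum_nat_pred (T : finType) (P : pred T) : \sum_(y : T) P y = #|P|.
Proof.
rewrite -sum1_card [RHS]big_mkcond; apply: eq_bigr => y _ /=.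
by rewrite unfold_in; case: (P y).
Qed.

Section GridDesign.

Variables X Y Z : finType.
Implicit Types (x y : X * Y * Z) (J : bool * bool * bool).

Lemma difference_type_eq0 x y :
  (difference_type x y == (false, false, false)) = (x == y).
Proof.
case: x y => [[x1 x2] x3] [[y1 y2] y3].
by rewrite /difference_type !xpair_eqE /=; do !case: eqP.
Qed.

Lemma grid_groupP (h : {perm X * Y * Z}) :
  reflect (exists g, h = grid_perm g) (h \in grid_group X Y Z).
Proof.
apply: (iffP morphimP) => [[g _ _ ->]|[g ->]]; first by exists g.
by exists g; rewrite ?inE.
Qed.

Lemma difference_type_grid h x y : h \in grid_group X Y Z ->
  difference_type (h x) (h y) = difference_type x y.
Proof.
case/grid_groupP=> g ->.
by rewrite /difference_type !permE /= !(inj_eq perm_inj).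
Qed.

Lemma perm2_transitive (T : finType) (a b c d : T) :
  (a == b) = (c == d) -> exists s : {perm T}, s a = c /\ s b = d.
Proof.
case: (altP (a =P b)) => [<- /esym/eqP <-|ab /esym/negbT cd].
  by exists (tperm a c); rewrite tpermL.
(* The first transposition sends a to c, the second sends the image of b to d and fixes c, which
   differs from both entries it swaps. *)
exists (tperm a c * tperm (tperm a c b) d)%g; rewrite !permM tpermL; split.
  rewrite tpermD //; last by rewrite eq_sym.
  by rewrite -{2}(tpermL a c) (inj_eq perm_inj) eq_sym.
by rewrite tpermL.
Qed.

(** The coordinates are permuted independently, and in each one the type records exactly whether the
    two entries agree. *)
Lemma grid_group_transitive_on_types x y x' y' :
  difference_type x y = difference_type x' y' ->
  exists2 h, h \in grid_group X Y Z & h x = x' /\ h y = y'.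
Proof.
case: x y x' y' => [[x1 x2] x3] [[y1 y2] y3] [[x1' x2'] x3'] [[y1' y2'] y3'].
case=> /negb_inj/perm2_transitive[s1 [s1x s1y]].
move=> /negb_inj/perm2_transitive[s2 [s2x s2y]].
move=> /negb_inj/perm2_transitive[s3 [s3x s3y]].
exists (grid_perm (s1, s2, s3)); first by apply/grid_groupP; eexists.
by rewrite !permE /grid_fun /= s1x s1y s2x s2y s3x s3y.
Qed.

Lemma sum_neq (T : finType) (x : T) (b : bool) :
  \sum_(y : T) ((x != y) == b) = if b then #|T|.-1 else 1.
Proof.
rewrite sum_nat_pred; case: b.
  by rewrite -(cardC1 x); apply: eq_card => y; rewrite !inE unfold_in eqb_id eq_sym.
by rewrite -(card1 x); apply: eq_card => y; rewrite !inE unfold_in eqbF_neg negbK eq_sym.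
Qed.

Lemma card_of_type J :
  \sum_(x : X * Y * Z) \sum_(y : X * Y * Z) (difference_type x y == J) =
    #|{: X * Y * Z}| * weight #|X| #|Y| #|Z| J.
Proof.
rewrite -sum_nat_const; apply: eq_bigr => x _.
case: J => [[J1 J2] J3]; rewrite /weight /=.
rewrite -(sum_neq x.1.1 J1) -(sum_neq x.1.2 J2) -(sum_neq x.2 J3).
rewrite big_distrlr /= pair_big /= big_distrlr /= pair_big /=.
by apply: eq_bigr => y _; rewrite !xpair_eqE !mulnb.
Qed.

Variable B : {set X * Y * Z}.

Lemma card_incidence_structure b :
  b \in incidence_structure B (grid_group X Y Z) -> #|b| = #|B|.
Proof. by case/imsetP => h _ ->; rewrite /= /setact card_imset //; apply: act_inj. Qed.

(* Double counting of flags: the group is transitive on ordered pairs of each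
   difference type, so the number of blocks through a pair is determined by
   the number of pairs of that type inside a block. *)
Lemma grid_2design :
  (forall J, J != (false, false, false) ->
    \sum_(x in B) \sum_(y in B) (difference_type x y == J) =
      weight #|X| #|Y| #|Z| J) ->
  is_2design #|{: X * Y * Z}| #|B|
    (#|incidence_structure B (grid_group X Y Z)| %/ #|{: X * Y * Z}|)
    (incidence_structure B (grid_group X Y Z)).
Proof.
set D := incidence_structure _ _; move=> hB.
split=> // [|x y xy]; first exact: card_incidence_structure.
pose lam u w := #|[set b in D | (u \in b) && (w \in b)]|.
rewrite -/(lam x y); set J := difference_type x y.
have J0 : J != (false, false, false) by rewrite difference_type_eq0.
have DG h b : h \in grid_group X Y Z -> ('P^*%act b h \in D) = (b \in D).
  exact: orbit_actr.
have lamJ u w : difference_type u w == J -> lam u w = lam x y.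
  move/eqP => uwJ; have [h hG [<- <-]] := grid_group_transitive_on_types uwJ.
  rewrite /lam -(card_imset _ (act_inj 'P^* h)); apply: eq_card => b.
  rewrite -(actKV 'P^* h b); move: ('P^*%act b _) => c.
  rewrite (mem_imset _ _ (act_inj 'P^* h)) !inE DG //=.
  by rewrite !(mem_imset _ _ perm_inj).
have key : #|{: X * Y * Z}| * weight #|X| #|Y| #|Z| J * lam x y =
    #|D| * weight #|X| #|Y| #|Z| J.
  rewrite -card_of_type -(hB J J0) big_distrl /=.
  transitivity (\sum_(u : X * Y * Z) \sum_(w : X * Y * Z) \sum_(b in D)
      [&& u \in b, w \in b & difference_type u w == J]).
    apply: eq_bigr => u _; rewrite big_distrl; apply: eq_bigr => w _ /=.
    case: eqP => [/eqP/lamJ<-|_].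
      rewrite mul1n /lam -sum1_card big_mkcond [RHS]big_mkcond /=.
      apply: eq_bigr => b _; rewrite inE andbT.
      by case: (b \in D) => //=; case: (_ && _).
    by rewrite mul0n big1 // => b _; rewrite !andbF.
  transitivity (\sum_(b in D) \sum_(u : X * Y * Z) \sum_(w : X * Y * Z)
      [&& u \in b, w \in b & difference_type u w == J]).
    by rewrite [RHS]exchange_big; apply: eq_bigr => u _; apply: exchange_big.
  (* Every block is an image of B; reindexing both points by h preserves types and leaves the count
     for B itself. *)
  rewrite -sum_nat_const; apply: eq_bigr => b /imsetP[h hG ->] /=.
  rewrite (reindex_inj (@perm_inj _ h)) [RHS]big_mkcond; apply: eq_bigr => u _ /=.
  rewrite (reindex_inj (@perm_inj _ h)) /= (mem_imset _ _ perm_inj).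
  case: ifP => _; last by rewrite big1.
  rewrite [RHS]big_mkcond; apply: eq_bigr => w _.
  rewrite (mem_imset _ _ perm_inj) difference_type_grid //=.
  by case: ifP.
(* The pair (x, y) itself has type J, so both factors are positive; the weight can then be
   cancelled. *)
have /andP[v0 w0] : (0 < #|{: X * Y * Z}|) && (0 < weight #|X| #|Y| #|Z| J).
  rewrite -muln_gt0 -card_of_type (bigD1 x) //= (bigD1 y) //=.
  by rewrite eqxx.
move: key; rewrite mulnAC => /eqP; rewrite eqn_pmul2r // => /eqP <-.
by rewrite mulKn.
Qed.

End GridDesign.

(** * Counting pairs *)

Definition pairs (T : Type) (P : rel T) (s : seq T) : nat :=
  \sum_(x <- s) count (P x) s.

Lemma count_sum (T : Type) (P : pred T) (s : seq T) :
  count P s = \sum_(x <- s) P x.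
Proof. by elim: s => [|x s IHs]; rewrite (big_nil, big_cons) //= IHs. Qed.

Lemma sum_seq_const (T : eqType) (s : seq T) (F : T -> nat) (c : nat) :
  {in s, forall x, F x = c} -> \sum_(x <- s) F x = size s * c.
Proof.
by move=> Fc; rewrite (eq_big_seq _ Fc) big_const_seq count_predT iter_addn_0 mulnC.
Qed.

Definition within (K : bool * bool * bool) (x y : nat * nat * nat) : bool :=
  [&& K.1.1 || (x.1.1 == y.1.1), K.1.2 || (x.1.2 == y.1.2) & K.2 || (x.2 == y.2)].

Definition types_within (K : bool * bool * bool) : seq (bool * bool * bool) :=
  let range (k : bool) := if k then [:: false; true] else [:: false] in
  [seq (J, J3) | J <- [seq (J1, J2) | J1 <- range K.1.1, J2 <- range K.1.2],
                 J3 <- range K.2].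

Lemma pairs_within_split (s : seq (nat * nat * nat)) (K : bool * bool * bool) :
  pairs (within K) s =
    \sum_(J <- types_within K) pairs (fun x y => difference_type x y == J) s.
Proof.
rewrite exchange_big; apply: eq_bigr => x _ /=.
under [RHS]eq_bigr => J _ do rewrite count_sum.
rewrite exchange_big count_sum; apply: eq_bigr => y _ /=.
rewrite /within /difference_type; case: K => [[[] []] []] /=;
  rewrite !big_cons big_nil /=;
  by do !case: eqP.
Qed.

Definition product_within (a b c : nat) (K : bool * bool * bool) : nat :=
  (if K.1.1 then a else 1) * (if K.1.2 then b else 1) * (if K.2 then c else 1).

(** Moebius inversion over the subsets of J: for nonempty J the constant k cancels, and the
    alternating sum of products of sizes is the product of the sizes less one. *)
Lemma pairs_difference (s : seq (nat * nat * nat)) (k a b c : nat) :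
  (forall K, pairs (within K) s = k + product_within a.+1 b.+1 c.+1 K) ->
  forall J, J != (false, false, false) ->
    pairs (fun x y => difference_type x y == J) s = weight a.+1 b.+1 c.+1 J.
Proof.
move=> hs J J0.
have key K := etrans (esym (pairs_within_split s K)) (hs K).
move: (key (false, false, false)) (key (true, false, false))
  (key (false, true, false)) (key (false, false, true))
  (key (true, true, false)) (key (true, false, true))
  (key (false, true, true)) (key (true, true, true)).
rewrite /types_within /product_within /weight /= !big_cons !big_nil /=.
by case: J J0 => [[[] []] []] //= _; lia.
Qed.

Lemma flatten_pairs n :
  flatten [seq [:: 2 * i - 1; 2 * i] | i <- iota 1 n] = iota 1 (2 * n).
Proof.
elim: n => // n IHn; rewrite -(addn1 n) mulnDr (iotaD _ n 1) (iotaD _ (2 * n)).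
rewrite map_cat flatten_cat IHn /=.
by congr (_ ++ [:: _; _]); lia.
Qed.

(* An entry (a, b, i) of L stands for the two points (a, b, 2i - 1), (a, b, 2i). *)
Definition layers (Q : seq (nat * nat)) (L : seq (nat * nat * nat)) :
    seq (nat * nat * nat) :=
  [seq (x, 0) | x <- Q] ++
  flatten [seq pair_at t.1.1 t.1.2 (2 * t.2) | t <- L].

Section Layers.

Variables (Q : seq (nat * nat)) (L : seq (nat * nat * nat)) (N : nat).
Hypothesis uniqQL : uniq (Q ++ map fst L).
Hypothesis thirdL : perm_eq (map snd L) (iota 1 N).

Lemma sum_layers (F : nat * nat * nat -> nat) :
  \sum_(x <- layers Q L) F x =
    \sum_(x <- Q) F (x, 0) +
    \sum_(t <- L) (F (t.1, 2 * t.2 - 1) + F (t.1, 2 * t.2)).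
Proof.
rewrite big_cat big_map big_flatten big_map; congr (_ + _).
by apply: eq_bigr => -[[a b] i] _; rewrite /= !big_cons big_nil /= addn0.
Qed.

Lemma count_layers (P : pred (nat * nat)) :
  count (fun x => P x.1) (layers Q L) = count P Q + 2 * count P (map fst L).
Proof.
rewrite !count_sum sum_layers big_map big_distrr /=; congr (_ + _).
by apply: eq_bigr => t _; rewrite mul2n addnn.
Qed.

Lemma size_layers : size (layers Q L) = size Q + 2 * size L.
Proof. by rewrite -!(count_predT) (count_layers predT) count_map. Qed.

Let upper := flatten [seq pair_at t.1.1 t.1.2 (2 * t.2) | t <- L].

Lemma third_upper : perm_eq (map snd upper) (iota 1 (2 * N)).
Proof.
rewrite map_flatten -map_comp.
rewrite (eq_map (g := (fun i => [:: 2 * i - 1; 2 * i]) \o snd)) //.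
by rewrite map_comp -flatten_pairs perm_flatten // perm_map.
Qed.

Lemma upper_gt0 x : x \in upper -> 0 < x.2.
Proof. by move/(map_f snd); rewrite (perm_mem third_upper) mem_iota => /andP[]. Qed.

Lemma uniq_layers : uniq (layers Q L).
Proof.
have uniqQ : uniq Q by move: uniqQL; rewrite cat_uniq => /and3P[].
rewrite cat_uniq map_inj_uniq => [|x y [] //].
rewrite uniqQ (map_uniq (f := snd)) ?(perm_uniq third_upper) ?iota_uniq // andbT.
apply/hasPn => x /upper_gt0; apply: contraTN => /mapP[y _ ->].
by rewrite ltnn.
Qed.

(** Layer 0 is a copy of Q; every other layer holds a single point, which pairs only with itself, by
    reflexivity of R. *)
Lemma pairs_same_third (R : rel (nat * nat)) : reflexive R ->
  pairs (fun x y => R x.1 y.1 && (x.2 == y.2)) (layers Q L) = pairs R Q + 2 * size L.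
Proof.
move=> Rxx; rewrite /pairs /layers -/upper big_cat big_map /=; congr (_ + _).
  apply: eq_bigr => x _; rewrite count_cat count_map /=.
  rewrite (eq_in_count (a2 := pred0) (s := upper)) ?count_pred0 => [|y /upper_gt0 /=].
    by rewrite addn0; apply: eq_count => y /=; rewrite eqxx andbT.
  by rewrite lt0n eq_sym => /negbTE->; rewrite andbF.
rewrite (sum_seq_const (c := 1)) => [|x xU].
  by rewrite muln1; have := size_layers; rewrite /layers size_cat size_map => /addnI.
rewrite count_cat count_map (eq_count (a2 := pred0)) ?count_pred0 => [|y /=]; last first.
  by have := upper_gt0 xU; rewrite lt0n => /negbTE->; rewrite andbF.
apply/eqP; rewrite eqn_leq; apply/andP; split; last first.
  by rewrite add0n -has_count; apply/hasP; exists x; rewrite ?Rxx ?eqxx.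
have <- : count (pred1 x.2) (map snd upper) = 1.
  rewrite count_uniq_mem ?(map_f snd xU) // (perm_uniq third_upper).
  exact: iota_uniq.
by rewrite count_map; apply: sub_count => y /= /andP[_]; rewrite eq_sym.
Qed.

(** One point lies over each cell of Q and two over each cell of L, so a cell of L yields four
    ordered pairs. *)
Lemma pairs_same_cell :
  pairs (fun x y => x.1 == y.1) (layers Q L) = size Q + 4 * size L.
Proof.
have cnt c : count (fun y => c == y.1) (layers Q L) =
    (c \in Q) + 2 * (c \in map fst L).
  rewrite (count_layers (eq_op c)) -!count_uniq_mem.
  - by congr (_ + 2 * _); apply: eq_count => y; rewrite /= eq_sym.
  - by move: uniqQL; rewrite cat_uniq => /and3P[].
  - by move: uniqQL; rewrite cat_uniq => /and3P[].
have disj c : c \in map fst L -> c \notin Q.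
  by move: uniqQL; rewrite cat_uniq => /and3P[_ /hasPn QL _]; apply: QL.
rewrite /pairs sum_layers (sum_seq_const (c := 1)) => [|x xQ]; last first.
  by rewrite cnt xQ (contraTF (disj x)).
rewrite (sum_seq_const (c := 4)) => [|t tL]; first by rewrite muln1 (mulnC 4).
by rewrite !cnt (map_f fst tL) (negbTE (disj _ (map_f fst tL))).
Qed.

End Layers.

(** * Blocks of columns *)

(** The common shape of the four families of B_3 for p > 2: K columns of M cells, to the right of
    column o, numbered from i0 + 1 on. *)
Definition block (o i0 K M : nat) (beta : nat -> nat -> nat) : seq (nat * nat * nat) :=
  [seq (o + a, beta a b, i0 + (a + (b - 1) * K)) | a <- iota 1 K, b <- iota 1 M].

Section Block.

Variables (o i0 K M : nat) (beta : nat -> nat -> nat).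
Let L := block o i0 K M beta.

Lemma size_block : size L = K * M.
Proof. by rewrite size_allpairs !size_iota. Qed.

Lemma sum_block (F : nat * nat * nat -> nat) :
  \sum_(t <- L) F t = \sum_(a <- iota 1 K) \sum_(b <- iota 1 M)
     F (o + a, beta a b, i0 + (a + (b - 1) * K)).
Proof. by rewrite /L /block big_allpairs_dep. Qed.

Lemma mem_cells_block c : c \in map fst L ->
  exists a b, [/\ 0 < a <= K, 0 < b <= M & c = (o + a, beta a b)].
Proof.
case/mapP => _ /allpairsP[[a b] /= [aK bM ->] ->].
by exists a, b; move: aK bM; rewrite !mem_iota !add1n !ltnS.
Qed.

(** With a from 1 to K, a + (b - 1) K determines a and b; so these K M numbers are distinct, and
    they fill an interval of that length. *)
Lemma third_block : perm_eq (map snd L) (iota i0.+1 (K * M)).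
Proof.
have sL : size (map snd L) = K * M by rewrite size_map size_block.
have uL : uniq (map snd L).
  rewrite map_allpairs; apply: allpairs_uniq; rewrite ?iota_uniq //.
  move=> _ _ /allpairsP[[a b] /= [aK bM ->]] /allpairsP[[a' b'] /= [aK' bM' ->]] /=.
  rewrite !mem_iota in aK bM aK' bM' => /addnI.
  have [->|[|]] : b = b' \/ b < b' \/ b' < b by lia.
  - by move/addIn=> ->.
  - by move=> ?; nia.
  - by move=> ?; nia.
apply: uniq_perm; rewrite ?iota_uniq //.
apply: (uniq_min_size uL _ _).2; last by rewrite sL size_iota.
rewrite map_allpairs => _ /allpairsP[[a b] /= [aK bM ->]].
rewrite !mem_iota in aK bM *; nia.
Qed.

Lemma uniq_cells_block :
  (forall a, {in [pred b | 0 < b <= M] &, injective (beta a)}) -> uniq (map fst L).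
Proof.
move=> betaI; rewrite map_allpairs; apply: allpairs_uniq; rewrite ?iota_uniq //.
move=> _ _ /allpairsP[[a b] /= [aK bM ->]] /allpairsP[[a' b'] /= [aK' bM' ->]] /=.
rewrite !mem_iota !add1n !ltnS in bM bM'.
by case=> /addnI-> /betaI->.
Qed.

Lemma count_first_block a0 :
  count (fun c => c.1 == a0) (map fst L) = M * (o < a0 <= o + K).
Proof.
rewrite count_sum big_map sum_block /=.
under eq_bigr => a _ do rewrite big_const_seq count_predT iter_addn_0 size_iota mulnC.
rewrite -big_distrr /=; congr (_ * _).
have -> : (o < a0 <= o + K) = (a0 \in iota (o + 1) K) by rewrite mem_iota; lia.
rewrite -count_uniq_mem ?iota_uniq // iotaDl count_sum big_map.
by apply: eq_bigr.
Qed.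

End Block.

(** * The base block for p > 2 *)

Lemma sum_iota_eq (i n x0 c : nat) :
  \sum_(x <- iota i n) (c + x == x0) = (c + i <= x0 < c + i + n).
Proof.
rewrite -mem_iota -count_uniq_mem ?iota_uniq // iotaDl count_sum big_map.
by apply: eq_bigr.
Qed.

Lemma sum_iota_if (n a0 x y : nat) : 0 < a0 <= n ->
  \sum_(a <- iota 1 n) (if a == a0 then x else y) = x + (n - 1) * y.
Proof.
move=> a0n; have a0i : a0 \in iota 1 n by rewrite mem_iota; lia.
rewrite (bigD1_seq a0) ?iota_uniq //= eqxx; congr (_ + _).
rewrite (eq_bigr (fun=> y)) => [|a /negbTE-> //].
rewrite big_const_seq iter_addn_0 mulnC; congr (_ * _).
have := count_predC (pred1 a0) (iota 1 n).
by rewrite size_iota count_uniq_mem ?iota_uniq // a0i => E; rewrite -[in RHS]E addKn.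
Qed.

Lemma uniq_cat_sep (T : eqType) (f : T -> nat) (c : nat) (s1 s2 : seq T) :
  {in s1, forall x, f x <= c} -> {in s2, forall x, c < f x} ->
  uniq s1 -> uniq s2 -> uniq (s1 ++ s2).
Proof.
move=> s1c s2c us1 us2; rewrite cat_uniq us1 us2 andbT /=.
by apply/hasPn => x /s2c; apply: contraTN => /s1c; rewrite -leqNgt.
Qed.

Section Ground.

Variables p n : nat.

(** This is B' for n = (p^2 - p) / 2: b is 2a - 1 or 2a exactly when [uphalf b] is a, so b alone
    indexes the second part. *)
Definition ground : seq (nat * nat) :=
  [seq (a, 0) | a <- iota 0 p.+1] ++ [seq (p + uphalf b, b) | b <- iota 1 (2 * n)].

Lemma size_ground : size ground = p + 1 + 2 * n.
Proof. by rewrite size_cat !size_map !size_iota addn1. Qed.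

Lemma count_ground_first a0 :
  count (fun c => c.1 == a0) ground = (a0 <= p) + 2 * (p < a0 <= p + n).
Proof.
rewrite count_cat !count_sum !big_map /=; congr (_ + _).
  by rewrite (sum_iota_eq 0 p.+1 a0 0) add0n ltnS.
rewrite -flatten_pairs big_flatten big_map /=.
rewrite (eq_bigr (fun a => 2 * (p + a == a0))) => [|a _].
  by rewrite -big_distrr /= sum_iota_eq; lia.
by rewrite /= !big_cons big_nil /=; lia.
Qed.

Lemma count_ground_second b0 :
  count (fun c => c.2 == b0) ground = (p + 1) * (b0 == 0) + (0 < b0 <= 2 * n).
Proof.
rewrite count_cat !count_sum !big_map /=; congr (_ + _).
  rewrite (sum_seq_const (c := b0 == 0)) => [|a _]; last by rewrite eq_sym.
  by rewrite /= size_iota addn1.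
by rewrite (sum_iota_eq 1 (2 * n) b0 0); lia.
Qed.

End Ground.

Section Configuration.

Variables p n m m' : nat.
Notation ground := (ground p n).
Hypotheses (p_gt0 : 0 < p) (n_gt1 : 1 < n) (mm' : m + m' = 2 * n).

(* For b > 0, [uphalf b == a] means that b is 2a - 1 or 2a; when b <= n this
   already forces a <= (n + 1) / 2. *)
Definition shift2 (a b : nat) := if uphalf b == a then b + n else b.
Definition shift4 (a b : nat) := if a == 1 then b else b + n.

Definition columns1 := block 0 0 p m (fun=> id).
Definition columns2 := block p (p * m) n n shift2.
Definition columns3 := block (p + n) (p * m + n * n) p m' (fun=> addn m).
Definition columns4 := block (2 * p + n) (p * m + n * n + p * m') n n shift4.
(* The offset of each block in the third coordinate is the total number of
   cells in the preceding ones, so that the indices run through 1, ..., 2n(p + n). *)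
Definition columns := columns1 ++ columns2 ++ columns3 ++ columns4.

Lemma size_columns : size columns = 2 * n * (p + n).
Proof. by rewrite !size_cat !size_block; nia. Qed.

Lemma third_columns : perm_eq (map snd columns) (iota 1 (2 * n * (p + n))).
Proof.
have -> : 2 * n * (p + n) = p * m + (n * n + (p * m' + n * n)) by nia.
rewrite /columns !map_cat !iotaD !perm_cat //.
- exact: third_block.
- by rewrite add1n; apply: third_block.
- by rewrite add1n addSn; apply: third_block.
- by rewrite add1n !addSn; apply: third_block.
Qed.

(** Row 0 is split off first, then ranges of columns; only the columns from p + 1 to p + n contain
    both ground points and cells of a block. *)
Lemma uniq_cells : uniq (ground ++ map fst columns).
Proof.
rewrite -catA; apply: (uniq_cat_sep (f := snd) (c := 0)).
- by move=> _ /mapP[a _ ->].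
- move=> c; rewrite !map_cat !mem_cat => /or4P[/mapP[b]|||/orP[]].
  + by rewrite mem_iota => /andP[b0 _] ->.
  + by case/mem_cells_block => a [b [_ /andP[b0 _] ->]].
  + case/mem_cells_block => a [b [_ /andP[b0 _] ->]].
    by rewrite /shift2; case: ifP => _ /=; lia.
  + by case/mem_cells_block => a [b [_ /andP[b0 _] ->]] /=; lia.
  + case/mem_cells_block => a [b [_ /andP[b0 _] ->]].
    by rewrite /shift4; case: ifP => _ /=; lia.
- by rewrite map_inj_uniq ?iota_uniq // => a b [].
rewrite /columns !map_cat.
(* Moving [columns1] to the front puts the ranges of first coordinates in increasing order. *)
rewrite (perm_uniq (s2 := map fst columns1 ++
  [seq (p + uphalf b, b) | b <- iota 1 (2 * n)] ++
  map fst columns2 ++ map fst columns3 ++ map fst columns4)); last by rewrite perm_catCA.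
apply: (uniq_cat_sep (f := fst) (c := p)).
- by move=> c /mem_cells_block[a [b [ap _ ->]]] /=; lia.
- move=> c; rewrite !mem_cat => /or4P[/mapP[b]|||].
  + by rewrite mem_iota => b0 -> /=; lia.
  + by case/mem_cells_block => a [b [a0 _ ->]] /=; lia.
  + by case/mem_cells_block => a [b [a0 _ ->]] /=; lia.
  + by case/mem_cells_block => a [b [a0 _ ->]] /=; lia.
- by apply: uniq_cells_block => a b b' _ _.
rewrite catA; apply: (uniq_cat_sep (f := fst) (c := p + n)).
- move=> c; rewrite mem_cat => /orP[/mapP[b]|].
  + by rewrite mem_iota => b0 -> /=; lia.
  + by case/mem_cells_block => a [b [a0 _ ->]] /=; lia.
- move=> c; rewrite mem_cat => /orP[].
  + by case/mem_cells_block => a [b [a0 _ ->]] /=; lia.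
  + by case/mem_cells_block => a [b [a0 _ ->]] /=; lia.
- rewrite cat_uniq map_inj_uniq ?iota_uniq => [|b b' [_ ->] //] /=.
  rewrite uniq_cells_block ?andbT => [|a b b' b0 b'0]; last first.
    by rewrite /shift2; rewrite !inE in b0 b'0; do 2 case: eqP => _; lia.
  apply/hasPn => c /mem_cells_block[a [b [a0 b0 ->]]].
  (* In column p + a the ground occupies rows 2a - 1 and 2a. A cell of [columns2] due there is
     raised by n, and n > 1 carries it past both. *)
  apply/negP => /mapP[b'] _ [/addnI]; rewrite /shift2.
  by case: eqP => [<- + E|? + E]; rewrite -E; lia.
apply: (uniq_cat_sep (f := fst) (c := 2 * p + n)).
- by move=> c /mem_cells_block[a [b [ap _ ->]]] /=; lia.
- by move=> c /mem_cells_block[a [b [ap _ ->]]] /=; lia.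
- by apply: uniq_cells_block => a b b' _ _ /addnI.
apply: uniq_cells_block => a b b' _ _.
by rewrite /shift4; case: ifP => // _ /addIn.
Qed.

Lemma count_columns_first a0 :
  count (fun c => c.1 == a0) (map fst columns) =
    m * (0 < a0 <= p) + n * (p < a0 <= p + n) +
    m' * (p + n < a0 <= 2 * p + n) + n * (2 * p + n < a0 <= 2 * p + 2 * n).
Proof.
rewrite !map_cat !count_cat !count_first_block.
by rewrite !addnA; congr (_ * _ + _ * _ + _ * _ + _ * _); lia.
Qed.

(** [columns1] and [columns3] together meet each row from 1 to 2n exactly p times. For b from 1 to
    n, [columns2] raises by n exactly one of its n cells of index b, and [columns4] all but one, so
    rows b and b + n are each met n times. *)
Lemma count_columns_second b0 :
  count (fun c => c.2 == b0) (map fst columns) = (p + n) * (0 < b0 <= 2 * n).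
Proof.
rewrite !map_cat !count_cat !count_sum !big_map !sum_block /=.
rewrite (sum_seq_const (c := (0 < b0 <= m : nat))) => [|a _]; last first.
  by rewrite (sum_iota_eq 1 m b0 0); lia.
rewrite [X in _ + (_ + (X + _))](sum_seq_const (c := (m < b0 <= m + m' : nat)));
  last move=> a _; last first.
  by rewrite sum_iota_eq; lia.
set S2 := \sum_(a <- _) _; set S4 := \sum_(a <- _) _.
have S24 : S2 + S4 = n * (0 < b0 <= 2 * n).
  rewrite /S2 /S4 exchange_big [X in _ + X]exchange_big -big_split /=.
  transitivity (\sum_(b <- iota 1 n) n * ((0 + b == b0) + (n + b == b0))).
    apply: eq_big_seq => b; rewrite mem_iota => bn.
    rewrite (eq_bigr (fun a =>
      if a == uphalf b then (n + b == b0 : nat) else (0 + b == b0))).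
      rewrite sum_iota_if; last lia.
      rewrite (eq_bigr (fun a =>
        if a == 1 then (0 + b == b0 : nat) else (n + b == b0))).
        rewrite sum_iota_if; last lia.
        by nia.
      by move=> a _; rewrite /shift4; case: ifP => // _; rewrite addnC.
    by move=> a _; rewrite /shift2 (eq_sym a); case: ifP => // _; rewrite addnC.
  rewrite -big_distrr big_split /= !sum_iota_eq; congr (_ * _); lia.
rewrite !size_iota; nia.
Qed.

End Configuration.

(** * Pairs agreeing in the first or the second coordinate, for p > 2 *)

Section Configuration.

Variables p n m m' : nat.
Notation L := (columns p n m m').
Notation Q := (ground p n).
Notation s := (layers Q L).

Lemma pairs_ground_first : pairs (fun x y => x.1 == y.1) Q = p + 1 + 4 * n.
Proof.
rewrite /pairs /ground big_cat !big_map.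
rewrite (sum_seq_const (c := 1)) => [|a]; last first.
  rewrite mem_iota => ap.
  rewrite (eq_count (a2 := fun c => c.1 == a)) => [|c]; last exact: eq_sym.
  rewrite -/(ground p n) count_ground_first; lia.
rewrite (sum_seq_const (c := 2)) => [|b]; last first.
  rewrite mem_iota => bn.
  rewrite (eq_count (a2 := fun c => c.1 == p + uphalf b)) => [|c]; last exact: eq_sym.
  rewrite -/(ground p n) count_ground_first; lia.
by rewrite !size_iota /=; lia.
Qed.

Lemma pairs_ground_second :
  pairs (fun x y => x.2 == y.2) Q = (p + 1) * (p + 1) + 2 * n.
Proof.
rewrite /pairs /ground big_cat !big_map.
rewrite (sum_seq_const (c := p + 1)) => [|a _]; last first.
  rewrite (eq_count (a2 := fun c => c.2 == 0)) => [|c]; last exact: eq_sym.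
  rewrite -/(ground p n) count_ground_second; lia.
rewrite (sum_seq_const (c := 1)) => [|b]; last first.
  rewrite mem_iota => bn.
  rewrite (eq_count (a2 := fun c => c.2 == b)) => [|c]; last exact: eq_sym.
  rewrite -/(ground p n) count_ground_second; nia.
by rewrite !size_iota /=; lia.
Qed.

Hypotheses (p_gt0 : 0 < p) (n_gt1 : 1 < n) (mm' : m + m' = 2 * n).

(** A sum of squared row sizes: row 0 has p + 1 points; each row from 1 to 2n has one point in layer
    0 and two over each of its p + n cells. *)
Lemma pairs_second :
  pairs (fun x y : nat * nat * nat => x.1.2 == y.1.2) s =
    (p + 1) * (p + 1) + (2 * n + 4 * n * (p + n)) * (2 * p + 2 * n + 1).
Proof.
have cnt b : count (fun y : nat * nat * nat => b == y.1.2) s =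
    (p + 1) * (b == 0) + (2 * p + 2 * n + 1) * (0 < b <= 2 * n).
  rewrite (count_layers Q L (fun c => b == c.2)).
  have flip : (fun c : nat * nat => b == c.2) =1 (fun c => c.2 == b).
    by move=> c; apply: eq_sym.
  rewrite !(eq_count flip).
  by rewrite count_ground_second count_columns_second //; lia.
rewrite /pairs sum_layers.
under eq_bigr do rewrite cnt.
under [X in _ + X]eq_bigr do rewrite !cnt.
rewrite /ground big_cat !big_map.
rewrite (sum_seq_const (c := p + 1)) => [|a _]; last by rewrite /=; lia.
rewrite (sum_seq_const (c := 2 * p + 2 * n + 1)) => [|b]; last first.
  by rewrite mem_iota /= => bn; nia.
rewrite (sum_seq_const (c := 2 * (2 * p + 2 * n + 1))) => [|t tL]; last first.
  suff bn : 0 < t.1.2 <= 2 * n by rewrite eqn0Ngt bn; case/andP: bn => -> _ /=; lia.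
  have : 0 < count (fun c => c.2 == t.1.2) (map fst L).
    by rewrite -has_count; apply/hasP; exists t.1 => //; apply: map_f.
  by rewrite count_columns_second //; case: (_ <= _ <= _) => //; rewrite muln0.
by rewrite !size_iota size_columns //=; nia.
Qed.

(** A sum of squared column sizes: column 0 has one point, and the next p, n, p and n columns have 1
    + 2m, 2 + 2n, 2m' and 2n points each. *)
Lemma pairs_first :
  pairs (fun x y : nat * nat * nat => x.1.1 == y.1.1) s =
    1 + p * (1 + 2 * m) * (1 + 2 * m) + 4 * n * (n + 1) * (n + 1) +
    4 * p * m' * m' + 4 * n * n * n.
Proof.
have cnt a : count (fun y : nat * nat * nat => a == y.1.1) s =
    (a <= p) + 2 * (p < a <= p + n) + 2 * (
    m * (0 < a <= p) + n * (p < a <= p + n) +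
    m' * (p + n < a <= 2 * p + n) + n * (2 * p + n < a <= 2 * p + 2 * n)).
  rewrite (count_layers Q L (fun c => a == c.1)).
  have flip : (fun c : nat * nat => a == c.1) =1 (fun c => c.1 == a).
    by move=> c; apply: eq_sym.
  rewrite !(eq_count flip).
  by rewrite count_ground_first count_columns_first.
rewrite /pairs sum_layers.
under eq_bigr do rewrite cnt.
under [X in _ + X]eq_bigr do rewrite !cnt.
rewrite /ground /columns !big_cat !big_map.
have -> : iota 0 p.+1 = [:: 0] ++ iota 1 p by [].
rewrite big_cat big_seq1.
rewrite (sum_seq_const (c := 1 + 2 * m)) => [|a]; last first.
  by rewrite mem_iota /= => ap; nia.
rewrite (sum_seq_const (c := 2 + 2 * n)) => [|b]; last first.
  by rewrite mem_iota /= => ap; nia.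
rewrite (sum_seq_const (c := 2 * (1 + 2 * m))) => [|t tB]; last first.
  by case/mem_cells_block: (map_f fst tB) => a [b [ap _ ->]] /=; nia.
rewrite (sum_seq_const (c := 2 * (2 + 2 * n))) => [|t tB]; last first.
  by case/mem_cells_block: (map_f fst tB) => a [b [ap _ ->]] /=; nia.
rewrite (sum_seq_const (c := 2 * (2 * m'))) => [|t tB]; last first.
  by case/mem_cells_block: (map_f fst tB) => a [b [ap _ ->]] /=; nia.
rewrite (sum_seq_const (c := 2 * (2 * n))) => [|t tB]; last first.
  by case/mem_cells_block: (map_f fst tB) => a [b [ap _ ->]] /=; nia.
rewrite !size_iota !size_block /=.
nia.
Qed.

End Configuration.

Lemma eq_pairs (T : Type) (P P' : rel T) (s : seq T) :
  P =2 P' -> pairs P s = pairs P' s.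
Proof. by move=> PP'; apply: eq_bigr => x _; apply: eq_count. Qed.

Lemma pairs_eq (T : eqType) (s : seq T) :
  uniq s -> pairs (fun x y => x == y) s = size s.
Proof.
move=> us; rewrite /pairs (sum_seq_const (c := 1)) ?muln1 // => x xs.
rewrite (eq_count (a2 := pred1 x)) ?count_uniq_mem ?xs //.
Qed.

Lemma pairs_true (T : eqType) (s : seq T) :
  pairs (fun _ _ => true) s = size s * size s.
Proof. by rewrite /pairs (sum_seq_const (c := size s)) // => x _; apply: count_predT. Qed.

(* In both cases 2m + 1 and 2m' are, in some order, p^2 and (p - 1)^2. *)
Lemma pairs_within_layers (p n m m' : nat) (K : bool * bool * bool) :
  0 < p -> 1 < n -> m + m' = 2 * n -> p * p = 2 * n + p ->
  2 * m + 1 = p * p /\ 2 * m' + 2 * p = p * p + 1 \/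
  2 * m + 2 * p = p * p /\ 2 * m' = p * p ->
  pairs (within K) (layers (ground p n) (columns p n m m')) =
    p ^ 4 + product_within (2 * n + 2 * p).+1 (2 * n).+1 (4 * n * (p + n)).+1 K.
Proof.
move=> p0 n1 mm' pp mE.
have u := uniq_cells p0 n1 mm'; have th := third_columns p0 n1 mm'.
have sC := size_columns p0 n1 mm'.
(* This is p^4 - p^2 = (p^2 - p)(p^2 + p) = 2n(2n + 2p), with p^2 written as 2n + p. *)
have p4 : p ^ 4 = 4 * n * (p + n) + 2 * n + p.
  by rewrite (expnM p 2 2) -!mulnn pp; nia.
have uQ : uniq (ground p n) by move: u; rewrite cat_uniq => /and3P[].
case: K => [[[] []] []]; rewrite /product_within /= ?muln1 ?mul1n.
- rewrite (eq_pairs (P' := fun _ _ => true)) // pairs_true size_layers.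
  rewrite size_ground sC p4.
  nia.
- rewrite (eq_pairs (P' := fun x y => true && (x.2 == y.2))) //.
  rewrite (pairs_same_third _ th (R := fun _ _ => true)) // pairs_true.
  rewrite size_ground sC p4.
  nia.
- rewrite (eq_pairs (P' := fun x y : nat * nat * nat => x.1.2 == y.1.2)); last first.
    by move=> x y; rewrite /within /= andbT.
  rewrite (pairs_second p0 n1 mm') p4.
  nia.
- rewrite (eq_pairs (P' := fun x y => (x.1.2 == y.1.2) && (x.2 == y.2))) //.
  rewrite (pairs_same_third _ th (R := fun x y => x.2 == y.2)) //.
  rewrite pairs_ground_second sC p4.
  nia.
- rewrite (eq_pairs (P' := fun x y : nat * nat * nat => x.1.1 == y.1.1)); last first.
    by move=> x y; rewrite /within /= andbT.
  (* Here m and m' enter only through p((2m + 1)^2 + (2m')^2), which has the same value in both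
     cases. *)
  rewrite (pairs_first p0 n1 mm') p4.
  nia.
- rewrite (eq_pairs (P' := fun x y => (x.1.1 == y.1.1) && (x.2 == y.2))) //.
  rewrite (pairs_same_third _ th (R := fun x y => x.1 == y.1)) //.
  rewrite pairs_ground_first sC p4.
  nia.
- rewrite (eq_pairs (P' := fun x y : nat * nat * nat => x.1 == y.1)); last first.
    by move=> [x1 x2] [y1 y2]; rewrite /within /= andbT.
  rewrite (pairs_same_cell u) size_ground sC p4.
  nia.
- rewrite (eq_pairs (P' := fun x y => (x.1 == y.1) && (x.2 == y.2))); last first.
    by move=> [[x1 x2] x3] [[y1 y2] y3]; rewrite /within /= andbA.
  rewrite (pairs_same_third _ th (R := fun x y => x == y)) //.
  rewrite (pairs_eq uQ) size_ground sC p4.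
  nia.
Qed.

(** * The base block in general *)

Lemma half_spec p : p * p = 2 * Defs.half p + p.
Proof.
have [q pE] : exists q, p ^ 2 - p = 2 * q.
  exists ((p ^ 2 - p) %/ 2); have := odd_double_half p.
  by rewrite -mulnn; nia.
by move: pE; rewrite /Defs.half => E; rewrite E mulKn // -E -mulnn; nia.
Qed.

(** Writing p as 2q + 1 or 2q makes every quotient exact. The last identity says that [c0] counts
    the cells of the first two families. *)
Lemma m_m'_c0_spec p : 1 < p ->
  [/\ m p + m' p = 2 * Defs.half p,
      2 * m p + 1 = p * p /\ 2 * m' p + 2 * p = p * p + 1 \/
      2 * m p + 2 * p = p * p /\ 2 * m' p = p * p &
      c0 p = p * m p + Defs.half p * Defs.half p].
Proof.
move=> p0; have hs := half_spec p.
rewrite /m /m' /c0; have := odd_double_half p; case: (odd p) => /= pE.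
  set q := p./2 in pE; have -> : p ^ 2 - 1 = 2 * (2 * q * (q + 1)).
    by rewrite -mulnn; nia.
  have -> : p ^ 2 - 2 * p + 1 = 2 * (2 * q * q).
    by rewrite -mulnn; nia.
  have hE : Defs.half p = q * (2 * q + 1) by nia.
  have -> : p ^ 4 + p ^ 2 - 2 * p =
      4 * (p * (2 * q * (q + 1)) + Defs.half p * Defs.half p).
    rewrite hE -pE (expnM _ 2 2) -!mulnn; nia.
  rewrite !mulKn //; split=> //; nia.
set q := p./2 in pE; have -> : p ^ 2 - 2 * p = 2 * (2 * q * (q - 1)).
  by rewrite -mulnn; nia.
have -> : p ^ 2  = 2 * (2 * q * q).
  by rewrite -mulnn; nia.
have hE : Defs.half p = q * (2 * q - 1) by nia.
have -> : p ^ 4 - 3 * (2 * (2 * q * q)) =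
    4 * (p * (2 * q * (q - 1)) + Defs.half p * Defs.half p).
  rewrite hE -pE (expnM _ 2 2) -!mulnn; nia.
rewrite !mulKn //; split=> //; nia.
Qed.

Lemma flatten_block (o i0 K M : nat) (beta : nat -> nat -> nat) g :
  (forall a b, 0 < a <= K -> 0 < b <= M ->
     g a b = pair_at (o + a) (beta a b) (2 * (i0 + (a + (b - 1) * K)))) ->
  flatten [seq g a b | a <- iota 1 K, b <- iota 1 M] =
  flatten [seq pair_at t.1.1 t.1.2 (2 * t.2) | t <- block o i0 K M beta].
Proof.
move=> gE; rewrite map_allpairs; congr flatten; apply/eq_in_allpairs => a b.
by rewrite !mem_iota !add1n !ltnS; apply: gE.
Qed.

Lemma B_seq_layers p : 2 < p ->
  B_seq p = layers (ground p (Defs.half p)) (columns p (Defs.half p) (m p) (m' p)).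
Proof.
move=> p2; have hs := half_spec p; have [|mm' _ c0E] := @m_m'_c0_spec p; first lia.
rewrite /B_seq /layers; congr (map _ _ ++ _).
  rewrite /B'_seq /ground -flatten_pairs map_flatten -map_comp.
  congr (_ ++ flatten _); apply: eq_map => a /=.
  by congr [:: (_, _); (_, _)]; lia.
rewrite /B3_seq ifN; last lia.
rewrite /columns !map_cat !flatten_cat /B31 /B32 /B33 /B34.
have -> : (p ^ 2 + p) %/ 2 = p + Defs.half p by rewrite -mulnn hs; lia.
have -> : (p ^ 2 + 3 * p) %/ 2 = 2 * p + Defs.half p by rewrite -mulnn hs; lia.
(* As m + m' = 2n, the offset of the last family counts the cells of the first three. *)
have -> : (p ^ 4 + 2 * p ^ 3 - 3 * p ^ 2) %/ 4 =
    p * m p + Defs.half p * Defs.half p + p * m' p.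
  have -> : p ^ 4 + 2 * p ^ 3 - 3 * p ^ 2 =
      4 * (2 * p * Defs.half p + Defs.half p * Defs.half p).
    rewrite (expnM p 2 2) (expnSr p 2) -!mulnn; nia.
  rewrite mulKn //; nia.
rewrite c0E; set n := Defs.half p in hs mm' *.
congr (_ ++ (_ ++ (_ ++ _))); apply: flatten_block => a b a0 b0.
- by congr (pair_at _ _); lia.
- congr (pair_at _ _); last lia.
  rewrite /delta2 /shift2 -/n.
  (* The floor is that of (n + 1) / 2, which [uphalf b] never exceeds for b at most n. *)
  have -> : (p ^ 2 - p + 2) %/ 4 = uphalf n by rewrite -mulnn hs; lia.
  rewrite !inE; case: ifP; case: ifP; lia.
- by congr (pair_at _ _); lia.
- congr (pair_at _ _); last lia.
  by rewrite /delta4 /shift4; case: ifP; rewrite ?addn0.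
Qed.

Lemma half_gt1 p : 2 < p -> 1 < Defs.half p.
Proof. by have := half_spec p; nia. Qed.

(** The successor forms of the three sizes are those required by [pairs_difference]. *)
Lemma e1E p : e1 p = (2 * Defs.half p + 2 * p).+1.
Proof. by rewrite /e1 -mulnn half_spec; lia. Qed.

Lemma e2E p : e2 p = (2 * Defs.half p).+1.
Proof. by rewrite /e2 -mulnn half_spec; lia. Qed.

Lemma e3E p : e3 p = (4 * Defs.half p * (p + Defs.half p)).+1.
Proof.
by have := half_spec p; rewrite /e3 (expnM p 2 2) -!mulnn; nia.
Qed.

Lemma pairs_B_seq p K : 1 < p ->
  pairs (within K) (B_seq p) = p ^ 4 + product_within (e1 p) (e2 p) (e3 p) K.
Proof.
rewrite leq_eqVlt => /predU1P[<-|p2].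
  (* For p = 2 the eight counts are evaluated, after turning the sum into the [sumn] of an explicit
     list. *)
  rewrite /pairs -(big_map (fun x => count (within K x) (B_seq 2)) predT id) -sumnE.
  by case: K => [[[] []] []]; vm_compute.
have [mm' mE _] := m_m'_c0_spec (ltnW p2).
rewrite B_seq_layers // e1E e2E e3E.
apply: pairs_within_layers => //; [lia|exact: half_gt1|exact: half_spec].
Qed.

Lemma uniq_B_seq p : 1 < p -> uniq (B_seq p).
Proof.
rewrite leq_eqVlt => /predU1P[<- //|p2].
have [mm' mE _] := m_m'_c0_spec (ltnW p2).
rewrite B_seq_layers //; apply: uniq_layers.
  by apply: uniq_cells; rewrite ?half_gt1 //; lia.
by apply: third_columns; rewrite ?half_gt1 //; lia.
Qed.

(** This is the count for empty K: distinct entries agree in all coordinates only with themselves,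
    and the empty product is 1. *)
Lemma size_B_seq p : 1 < p -> size (B_seq p) = p ^ 4 + 1.
Proof.
move=> p1; rewrite -(pairs_eq (uniq_B_seq p1)) -(@pairs_B_seq p (false, false, false)) //.
by apply: eq_pairs => -[[x1 x2] x3] [[y1 y2] y3]; rewrite /within /= andbA.
Qed.

Lemma ground_range p n c : c \in ground p n -> c.1 <= p + n /\ c.2 <= 2 * n.
Proof.
rewrite mem_cat => /orP[] /mapP[a]; rewrite mem_iota => aE -> /=; lia.
Qed.

Lemma columns_range p n m m' c : 0 < p -> 1 < n -> m + m' = 2 * n ->
  c \in map fst (columns p n m m') -> c.1 <= 2 * p + 2 * n /\ c.2 <= 2 * n.
Proof.
move=> p0 n1 mm' cL; split.
  have : 0 < count (fun c' => c'.1 == c.1) (map fst (columns p n m m')).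
    by rewrite -has_count; apply/hasP; exists c.
  by rewrite count_columns_first; nia.
have : 0 < count (fun c' => c'.2 == c.2) (map fst (columns p n m m')).
  by rewrite -has_count; apply/hasP; exists c.
by rewrite count_columns_second //; nia.
Qed.

(** Ensures that no listed triple is lost when B is taken among points with bounded coordinates. *)
Lemma B_seq_range p x : 1 < p -> x \in B_seq p ->
  [&& x.1.1 < e1 p, x.1.2 < e2 p & x.2 < e3 p].
Proof.
rewrite leq_eqVlt => /predU1P[<-|p2].
  have /allP : all (fun y : nat * nat * nat =>
    [&& y.1.1 < e1 2, y.1.2 < e2 2 & y.2 < e3 2]) (B_seq 2) by vm_compute.
  by apply.
have p1 := ltnW p2; have p0 := ltnW p1; have n1 := half_gt1 p2.
have [mm' _ _] := m_m'_c0_spec p1.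
rewrite B_seq_layers // e1E e2E e3E !ltnS mem_cat.
case/orP => [/mapP[c /ground_range[c1 c2] ->] /=|/flatten_mapP[t tL]].
  by rewrite c2 !andbT; apply: leq_trans c1 _; lia.
have := columns_range p0 n1 mm' (map_f fst tL).
have := map_f snd tL; rewrite (perm_mem (third_columns p0 n1 mm')) mem_iota.
case: t {tL} => -[a b] i /= /andP[_ i2] [a1 b2].
by rewrite !inE => /orP[] /eqP -> /=; apply/and3P; split; nia.
Qed.

(** This is the count for full K: all (p^4 + 1)^2 ordered pairs qualify, so the product of the sizes
    is (p^4 + 1)^2 - p^4. *)
Lemma card_point p : 1 < p -> #|point p| = p ^ 8 + p ^ 4 + 1.
Proof.
move=> p1; have := @pairs_B_seq p (true, true, true) p1.
rewrite (eq_pairs (P' := fun _ _ => true)) // pairs_true size_B_seq //.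
rewrite /product_within /= !card_prod !card_ord (expnM p 4 2) -mulnn; nia.
Qed.

(** * From lists of triples to sets of points *)

Definition coordinates (p : nat) (x : point p) : nat * nat * nat :=
  (nat_of_ord x.1.1, nat_of_ord x.1.2, nat_of_ord x.2).

Lemma coordinates_inj p : injective (@coordinates p).
Proof. by move=> [[x1 x2] x3] [[y1 y2] y3] [] /val_inj-> /val_inj-> /val_inj->. Qed.

Lemma perm_coordinates_B p : 1 < p ->
  perm_eq (map (@coordinates p) (enum (B p))) (B_seq p).
Proof.
move=> p1; apply: uniq_perm.
- by rewrite (map_inj_uniq (@coordinates_inj p)) enum_uniq.
- exact: uniq_B_seq.
move=> x; apply/mapP/idP => [[y yB ->]|xB]; first by move: yB; rewrite mem_enum inE.
have /and3P[x1 x2 x3] := B_seq_range p1 xB.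
exists (Ordinal x1, Ordinal x2, Ordinal x3).
  by rewrite mem_enum inE /=; move: xB; case: x {x1 x2 x3} => [[]].
by rewrite /coordinates /=; case: x {x1 x2 x3 xB} => [[]].
Qed.

Lemma sum_B p (F : nat * nat * nat -> nat) : 1 < p ->
  \sum_(x in B p) F (coordinates x) = \sum_(x <- B_seq p) F x.
Proof. by move=> p1; rewrite -(perm_big _ (perm_coordinates_B p1)) big_map big_enum. Qed.

Lemma card_B p : 1 < p -> #|B p| = p ^ 4 + 1.
Proof.
by move=> p1; rewrite -size_B_seq // -(perm_size (perm_coordinates_B p1)) size_map cardE.
Qed.

Lemma pairs_difference_B p J : 1 < p -> J != (false, false, false) ->
  \sum_(x in B p) \sum_(y in B p) (difference_type x y == J) =
    weight #|'I_(e1 p)| #|'I_(e2 p)| #|'I_(e3 p)| J.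
Proof.
move=> p1 J0; rewrite !card_ord.
(* The sizes are rewritten inside [weight] only, as they also parametrize the types of the
   points. *)
rewrite (f_equal3 (fun a b c => weight a b c J) (e1E p) (e2E p) (e3E p)).
rewrite -(@pairs_difference (B_seq p) (p ^ 4)) // => [|K]; last first.
  by rewrite pairs_B_seq // e1E e2E e3E.
rewrite /pairs -sum_B //; apply: eq_bigr => x _.
by rewrite count_sum -sum_B.
Qed.

Theorem proposition7p9 (p : nat) (hp : 1 < p) :
  [/\ exists lambda : nat,
        is_2design (p ^ 8 + p ^ 4 + 1) (p ^ 4 + 1) lambda (D3 p),
      grid_imprimitive3 (G p),
      G p \subset automorphism_group (D3 p) &
      [transitive G p, on D3 p | 'P^*]].
Proof.
split.
(* The double count of flags gives lambda times the number of points equal to the number of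
   blocks. *)
- exists (#|D3 p| %/ #|point p|); rewrite -card_point // -card_B //.
  exact: (grid_2design (fun J => @pairs_difference_B p J hp)).
- exists 'I_(e1 p), 'I_(e2 p), 'I_(e3 p), id; split; first exact: inv_bij.
    by rewrite !card_ord e1E e2E e3E; have := half_spec p; split; nia.
  by move=> h hG; exists h.
- exact: acts_orbit (subsetT _).
- exact: atrans_orbit.
Qed.
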